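(* Let $K$ be a field of arbitrary characteristic and let $R=\bigoplus_{n\geq 0}R_n$ be a finitely generated graded associative $K$-algebra with $R_0=0$ or $R_0=K$. If the Gelfand-Kirillov dimension $\mathrm{GKdim}(R)$ is finite, then the Hilbert series $H(R,t)=\sum_{n\geq 0}\dim_K(R_n)t^n$ is either rational or transcendental over $\mathbb{Q}(t)$; that is, if $H(R,t)$ is algebraic over $\mathbb{Q}(t)$, then it is a rational function in $\mathbb{Q}(t)$.
   Context: A $K$-algebra $R$ is graded if it is a direct sum of vector subspaces $R_0,R_1,R_2,\ldots$ (its homogeneous components) with $R_mR_n\subset R_{m+n}$ for all $m,n\geq 0$. It is assumed that $R_0=0$ or $R_0=K$; for a finitely generated $R$ all the components $R_n$ are then finite dimensional. The Hilbert series of $R$ is the formal power series $H(R,t)=\sum_{n\geq 0}\dim_K(R_n)t^n$. If $R$ is generated as an algebra by a finite dimensional vector space $V$, its growth function is $g_V(n)=\dim_K(V^0+V^1+\cdots+V^n)$, $n=0,1,2,\ldots$, where $V^i$ is the span of all products of $i$ elements of $V$ (and $V^0=K$ if $R$ is unital, $V^0=0$ otherwise). The Gelfand-Kirillov dimension is $\mathrm{GKdim}(R)=\limsup_{n\to\infty}\log_n(g_V(n))$; it does not depend on the choice of $V$. A power series $a(t)$ is rational if it is (the expansion at $0$ of) an element of $\mathbb{Q}(t)$, algebraic if $p(t,a(t))=0$ for some nonzero polynomial $p(t,z)\in\mathbb{Q}[t,z]$, and transcendental if it is not algebraic. *)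

(* Defs.v *)
From HB Require Import structures.
From mathcomp Require Import all_boot all_order all_algebra.
From mathcomp Require Import all_classical all_reals all_analysis.
Set Implicit Arguments.
Unset Strict Implicit.
Unset Printing Implicit Defensive.
Import Order.TTheory GRing.Theory Num.Theory.
Local Open Scope classical_set_scope.
Local Open Scope ring_scope.

(* No unit is required: [algType] would exclude the case R_0 = 0. *)
Record assocAlg (K : fieldType) := AssocAlg {
  alg_sort :> lmodType K;
  amul : alg_sort -> alg_sort -> alg_sort;
  amulA : associative amul;
  amulDl : left_distributive amul +%R;
  amulDr : right_distributive amul +%R;
  amulZl : forall (a : K) (x y : alg_sort), amul (a *: x) y = a *: amul x y;
  amulZr : forall (a : K) (x y : alg_sort), amul x (a *: y) = a *: amul x y
}.

Section LinearAlgebra.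
Variables (K : fieldType) (W : lmodType K).
Implicit Types (U A : set W).

Definition is_subspace U : Prop :=
  U 0 /\ forall (a : K) (x y : W), U x -> U y -> U (a *: x + y).

Definition lspan A : set W := smallest is_subspace A.

Definition lin_indep (d : nat) (b : 'I_d -> W) : Prop :=
  forall c : 'I_d -> K, \sum_(i < d) c i *: b i = 0 -> forall i, c i = 0.

Definition has_dim U (d : nat) : Prop :=
  exists b : 'I_d -> W, lin_indep b /\ lspan (range b) = U.

Definition finite_dim U : Prop := exists d, has_dim U d.

(* Junk value 0 when U is not a finite dimensional subspace. *)
Definition dimK U : nat := xget 0%N [set d | has_dim U d].

End LinearAlgebra.

Section Algebras.
Variables (K : fieldType) (R : assocAlg K).
Implicit Types (V S : set R) (G : nat -> set R).

Definition is_one (e : R) : Prop := forall x : R, amul e x = x /\ amul x e = x.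

(* Subalgebras of a unital algebra contain its unit, in accordance with the
   convention V^0 = K in the unital case. *)
Definition is_subalg S : Prop :=
  [/\ is_subspace S,
      forall x y, S x -> S y -> S (amul x y)
    & forall e, is_one e -> S e].

Definition generates V : Prop := smallest is_subalg V = setT.

(* The products of i elements of V; for i = 0 this is the set of identity elements
   of R, whose span is K.1 if R is unital and 0 otherwise. *)
Definition products V (i : nat) : set R :=
  match i with
  | 0%N => [set e | is_one e]
  | j.+1 => [set y | exists (x : R) (s : seq R),
      [/\ V x, forall z, z \in s -> V z, size s = j & y = foldl (@amul K R) x s]]
  end.

Definition vpow V (i : nat) : set R := lspan (products V i).

(* V^0 + V^1 + ... + V^n *)
Definition vpow_sum V (n : nat) : set R :=
  [set x | exists f : nat -> R,
     (forall i, vpow V i (f i)) /\ x = \sum_(i < n.+1) f i].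

Definition growth V (n : nat) : nat := dimK (vpow_sum V n).

(* The quotient is log_n (growth V n) for n >= 2. If R = 0 then growth V n = 0,
   and as [ln 0 = 0] the value is 0 rather than -oo. *)
Definition GKdim (RR : realType) V : \bar RR :=
  limn_esup (fun n : nat => (ln (growth V n)%:R / ln n%:R : RR)%:E).

Record is_grading G : Prop := IsGrading {
  grading_subspace : forall n, is_subspace (G n);
  grading_span : forall x : R, exists (N : nat) (f : nat -> R),
    (forall i, G i (f i)) /\ x = \sum_(i < N) f i;
  grading_direct : forall (N : nat) (f : nat -> R),
    (forall i, G i (f i)) -> \sum_(i < N) f i = 0 ->
    forall i, (i < N)%N -> f i = 0;
  grading_mul : forall m n x y, G m x -> G n y -> G (m + n)%N (amul x y)
}.

(* "R_0 = K": R is a nonzero unital algebra with R_0 = K.1 *)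
Definition degree0_is_field G : Prop :=
  exists e : R, [/\ e != 0, is_one e & G 0%N = [set c *: e | c in [set: K]]].

Definition hilbert_series G : nat -> rat := fun n => (dimK (G n))%:R.

End Algebras.

(* A formal power series over rat is represented by its coefficient sequence. *)
Section PowerSeries.
Implicit Types (a b : nat -> rat).

Definition fps_of_poly (p : {poly rat}) : nat -> rat := fun n => p`_n.

Definition fps_mul a b : nat -> rat :=
  fun n => \sum_(i < n.+1) a i * b (n - i)%N.

Definition fps_exp a (k : nat) : nat -> rat :=
  iter k (fps_mul a) (fps_of_poly 1).

(* p(t, a(t)), for p in Q[t][z] *)
Definition fps_eval (p : {poly {poly rat}}) a : nat -> rat :=
  fun n => \sum_(j < size p) fps_mul (fps_of_poly p`_j) (fps_exp a j) n.

Definition fps_rational a : Prop :=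
  exists p q : {poly rat},
    q`_0 != 0 /\ forall n, fps_mul (fps_of_poly q) a n = fps_of_poly p n.

Definition fps_algebraic a : Prop :=
  exists p : {poly {poly rat}}, p != 0 /\ forall n, fps_eval p a n = 0.

Definition fps_transcendental a : Prop := ~ fps_algebraic a.

End PowerSeries.

(* Main.v *)
Require Import Defs.
From mathcomp Require Import all_boot all_order all_algebra all_field.
From mathcomp Require Import ring zify.
From mathcomp Require Import all_classical all_reals all_analysis.
Set Implicit Arguments.
Unset Strict Implicit.
Unset Printing Implicit Defensive.
Import Order.TTheory GRing.Theory Num.Theory.
Local Open Scope classical_set_scope.
Local Open Scope ring_scope.

(** Each R_n lies in V^0 + ... + V^(kn) for a fixed k, so dim R_n is bounded by
    a polynomial in n and H(R, t) converges in the open unit disc. What remains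
    is Fatou's theorem for an integer power series a with P(t, a) = 0, where P
    is in Z[t][z] with leading coefficient c in Z[t]. For |t| < 1, Cauchy's
    bound for the roots of P(t, z) bounds |c a| uniformly; by Parseval the sum
    of the squares of the coefficients of c a is finite. As these are integers,
    c a is a polynomial.

    The analysis is finitary: a is truncated at order T, where P(t, a_T) is
    divisible by t^T and hence small on the circle of radius r < 1 for T large,
    and Parseval is applied to roots of unity in algC. *)

(** * Norms of polynomials *)

Section PolynomialNorm.
Variable R : numDomainType.
Implicit Types (p q : {poly R}) (P : {poly {poly R}}) (x y z : R).

Definition pnorm p : R := \sum_(i < size p) `|p`_i|.

Definition bipnorm P : R := \sum_(j < size P) pnorm P`_j.

Lemma pnorm_wide n p : (size p <= n)%N -> pnorm p = \sum_(i < n) `|p`_i|.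
Proof.
move=> le_pn; rewrite /pnorm (big_ord_widen n (fun i => `|p`_i|)) // big_mkcond.
by apply: eq_bigr => i _; case: ltnP => // /(nth_default 0) ->; rewrite normr0.
Qed.

Lemma pnorm_ge0 p : 0 <= pnorm p.
Proof. exact: sumr_ge0. Qed.

Lemma bipnorm_ge0 P : 0 <= bipnorm P.
Proof. by apply: sumr_ge0 => j _; apply: pnorm_ge0. Qed.

Lemma pnorm0 : pnorm 0 = 0.
Proof. by rewrite /pnorm size_poly0 big_ord0. Qed.

Lemma pnorm1 : pnorm 1 = 1.
Proof. by rewrite (@pnorm_wide 1) ?size_poly1 // big_ord1 coef1 normr1. Qed.

Lemma pnormD p q : pnorm (p + q) <= pnorm p + pnorm q.
Proof.
have szm := leq_maxl (size p) (size q); have szM := leq_maxr (size p) (size q).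
rewrite (pnorm_wide (size_polyD p q)) (pnorm_wide szm) (pnorm_wide szM).
rewrite -big_split; apply: ler_sum => i _ /=.
by rewrite coefD ler_normD.
Qed.

Lemma pnorm_sum (I : Type) (r : seq I) (A : pred I) (F : I -> {poly R}) :
  pnorm (\sum_(i <- r | A i) F i) <= \sum_(i <- r | A i) pnorm (F i).
Proof.
elim/big_rec2: _ => [|i y x _ le_xy]; first by rewrite pnorm0.
by apply: le_trans (pnormD _ _) _; rewrite lerD2l.
Qed.

Lemma pnorm_MXaddC p x : pnorm (p * 'X + x%:P) = `|x| + pnorm p.
Proof.
rewrite (@pnorm_wide (size p).+1); last by rewrite size_MXaddC; case: ifP.
rewrite big_ord_recl coefD coefMX coefC /= add0r; congr (_ + _).
by apply: eq_bigr => i _; rewrite coefD coefMX coefC /= addr0.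
Qed.

Lemma pnormZ x p : pnorm (x *: p) = `|x| * pnorm p.
Proof.
rewrite (@pnorm_wide (size p)) ?size_scale_leq // mulr_sumr.
by apply: eq_bigr => i _; rewrite coefZ normrM.
Qed.

Lemma pnormM p q : pnorm (p * q) <= pnorm p * pnorm q.
Proof.
elim/poly_ind: p => [|p x IHp]; first by rewrite mul0r pnorm0 mul0r.
have -> : (p * 'X + x%:P) * q = (p * q) * 'X + 0%:P + x *: q.
  by rewrite addr0 -mul_polyC; ring.
rewrite pnorm_MXaddC mulrDl.
apply: le_trans (pnormD _ _) _.
by rewrite pnorm_MXaddC normr0 add0r pnormZ addrC lerD2l.
Qed.

Lemma pnormX p n : pnorm (p ^+ n) <= pnorm p ^+ n.
Proof.
elim: n => [|n IHn]; first by rewrite !expr0 pnorm1.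
by rewrite !exprS (le_trans (pnormM _ _)) // ler_wpM2l ?pnorm_ge0.
Qed.

Lemma norm_horner_le_pnormM p z r n :
    `|z| <= r -> r <= 1 -> (forall i, (i < n)%N -> p`_i = 0) ->
  `|p.[z]| <= pnorm p * r ^+ n.
Proof.
move=> zr r1 p0; have r0 : 0 <= r by apply: le_trans zr.
rewrite horner_coef /pnorm mulr_suml; apply: le_trans (ler_norm_sum _ _ _) _.
apply: ler_sum => i _; rewrite normrM normrX.
have [/p0 -> | leni] := ltnP i n; first by rewrite normr0 !mul0r.
rewrite ler_wpM2l //; apply: (@le_trans _ _ (r ^+ i)); last exact: ler_wiXn2l.
by rewrite lerXn2r ?nnegrE.
Qed.

Lemma norm_horner_le_pnorm p z : `|z| <= 1 -> `|p.[z]| <= pnorm p.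
Proof.
move=> z1; have := @norm_horner_le_pnormM p z 1 0 z1 (lexx 1).
by rewrite mulr1; apply.
Qed.

Lemma pnorm_horner_leM P q y M :
    0 <= y <= 1 -> 1 <= M -> pnorm q * y <= M ->
  pnorm P.[q] * y ^+ size P <= bipnorm P * M ^+ size P.
Proof.
move=> /andP[y0 y1] M1 qyM; have M0 : 0 <= M := le_trans ler01 M1.
have yP0 : 0 <= y ^+ size P by rewrite exprn_ge0.
rewrite horner_coef [leRHS]mulr_suml.
apply: le_trans (ler_wpM2r yP0 (pnorm_sum _ _ _)) _.
rewrite mulr_suml; apply: ler_sum => j _.
apply: le_trans (ler_wpM2r yP0 (pnormM _ _)) _.
rewrite -mulrA ler_wpM2l ?pnorm_ge0 //.
apply: (@le_trans _ _ ((pnorm q * y) ^+ j)).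
  rewrite exprMn ler_pM ?pnorm_ge0 ?exprn_ge0 ?pnormX //.
  exact: ler_wiXn2l (ltnW (ltn_ord j)).
apply: (@le_trans _ _ (M ^+ j)); last exact: ler_weXn2l (ltnW (ltn_ord j)).
by rewrite lerXn2r ?nnegrE ?mulr_ge0 ?pnorm_ge0.
Qed.

(* Cauchy's bound for the roots of a polynomial, in a form which allows the
   leading coefficient to vanish: for |x| > 1 divide by x ^+ d. *)
Lemma norm_lead_mul_le d (c : nat -> R) x :
  `|c d.+1 * x| <= \sum_(j < d.+2) `|c j| + `|\sum_(j < d.+2) c j * x ^+ j|.
Proof.
set s := \sum_(j < _) _ * _.
have [x1 | x1] := real_leP (normr_real x) (real1 R).
  rewrite normrM big_ord_recr /= -addrA ler_wpDl ?sumr_ge0 // ler_wpDr //.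
  exact: ler_piMr.
have x0 : 0 < `|x| ^+ d by rewrite exprn_gt0 // (lt_trans ltr01).
rewrite -(ler_pM2r x0) -normrX -normrM -mulrA -exprS.
have -> : c d.+1 * x ^+ d.+1 = s - \sum_(j < d.+1) c j * x ^+ j.
  by rewrite /s big_ord_recr /= addrC addrK.
rewrite [X in _ <= (X + _) * _]big_ord_recr /= addrAC mulrDl.
rewrite ler_wpDr ?mulr_ge0 // addrC mulrDl.
apply: le_trans (ler_normB _ _) (lerD _ _).
  by rewrite ler_peMr // normrX exprn_ege1 // ltW.
rewrite mulr_suml; apply: le_trans (ler_norm_sum _ _ _) (ler_sum _ _) => j _.
by rewrite normrM !normrX ler_wpM2l // ler_weXn2l ?(ltW x1) // -ltnS.
Qed.

Lemma norm_lead_coef_horner_le P q z : (1 < size P)%N -> `|z| <= 1 ->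
  `|(lead_coef P * q).[z]| <= bipnorm P + `|P.[q].[z]|.
Proof.
move=> P1 z1; have [d szP] : exists d, size P = d.+2 by exists (size P).-2; lia.
have := @norm_lead_mul_le d (fun j => (P`_j).[z]) q.[z].
rewrite /lead_coef /bipnorm szP hornerM => /le_trans -> //; apply: lerD.
  by apply: ler_sum => j _; apply: norm_horner_le_pnorm.
rewrite [P.[q]]horner_coef szP horner_sum.
by under [X in _ <= `|X|]eq_bigr do rewrite hornerM horner_exp.
Qed.

End PolynomialNorm.

(** * Coefficients of bounded polynomials *)

Lemma sum_unity_root (F : fieldType) N (x : F) :
  x ^+ N = 1 -> \sum_(k < N) x ^+ k = if x == 1 then N%:R else 0.
Proof.
move=> xN; case: eqVneq => [-> | x1].
  under eq_bigr do rewrite expr1n.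
  by rewrite sumr_const card_ord.
apply: (mulfI (x := x - 1)); first by rewrite subr_eq0.
by rewrite -subrX1 xN subrr mulr0.
Qed.

Lemma prim_root_orthogonality (F : fieldType) N (w : F) (n m : 'I_N) :
    N.-primitive_root w ->
  \sum_(k < N) (w ^+ n / w ^+ m) ^+ k = if n == m then N%:R else 0.
Proof.
move=> prim_w; have wN := prim_expr_order prim_w.
have w0 : w != 0.
  apply: contra_eq_neq wN => ->.
  by rewrite expr0n (gtn_eqF (prim_order_gt0 prim_w)) eq_sym oner_eq0.
rewrite sum_unity_root; last first.
  by rewrite exprMn exprVn -!exprM !(mulnC _ N) !exprM wN !expr1n divr1.
rewrite -(inj_eq (mulIf (expf_neq0 m w0))) mulfVK ?expf_neq0 // mul1r.
by rewrite (eq_prim_root_expr prim_w) !modn_small.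
Qed.

Lemma norm_prim_root (C : numDomainType) N (w : C) :
  N.-primitive_root w -> `|w| = 1.
Proof.
move=> prim_w; apply/eqP; rewrite -(pexpr_eq1 (prim_order_gt0 prim_w)) //.
by rewrite -normrX (prim_expr_order prim_w) normr1.
Qed.

Lemma discrete_parseval (C : numClosedFieldType) N (w : C) (p : {poly C}) :
    N.-primitive_root w -> (size p <= N)%N ->
  \sum_(k < N) `|p.[w ^+ k]| ^+ 2 = N%:R * \sum_(n < N) `|p`_n| ^+ 2.
Proof.
move=> prim_w szp.
have wJ : w^* = w^-1.
  by rewrite invC_norm (norm_prim_root prim_w) expr1n invr1 mul1r.
transitivity (\sum_(n < N) \sum_(m < N)
    p`_n * (p`_m)^* * \sum_(k < N) (w ^+ n / w ^+ m) ^+ k).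
  under eq_bigr => k _.
    rewrite normCK (horner_coef_wide _ szp) rmorph_sum mulr_suml.
    under eq_bigr => n _ do rewrite mulr_sumr.
    over.
  rewrite exchange_big; apply: eq_bigr => n _ /=.
  rewrite exchange_big; apply: eq_bigr => m _ /=.
  rewrite mulr_sumr; apply: eq_bigr => k _.
  rewrite rmorphM !rmorphXn /= wJ exprMn !exprVn -!exprM (mulnC k) (mulnC k).
  by rewrite mulrACA.
rewrite [RHS]mulr_sumr; apply: eq_bigr => n _.
rewrite (bigD1 n) //= prim_root_orthogonality // eqxx -normCK mulrC.
rewrite [X in _ + X]big1 ?addr0 // => m m_n.
by rewrite prim_root_orthogonality // eq_sym (negPf m_n) mulr0.
Qed.

Lemma sum_sqr_coef_le (p : {poly algC}) (r M : algC) S :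
    0 <= r <= 1 -> (forall z, `|z| = r -> `|p.[z]| <= M) ->
  (\sum_(n < S) `|p`_n| ^+ 2) * r ^+ (2 * S) <= M ^+ 2.
Proof.
move=> /andP[r0 r1] pM.
have M0 : 0 <= M := le_trans (normr_ge0 _) (pM r (ger0_norm r0)).
pose N := (size p + S).+1; have N0 : 0 < N%:R :> algC by rewrite ltr0n.
have [w prim_w] := C_prim_root_exists (ltn0Sn (size p + S)).
pose h := \poly_(n < size p) (p`_n * r ^+ n).
have hE z : h.[z] = p.[r * z].
  rewrite horner_poly horner_coef; apply: eq_bigr => n _.
  by rewrite exprMn mulrA.
have coef_h n : h`_n = p`_n * r ^+ n.
  by rewrite coef_poly; case: ltnP => // /(nth_default 0) ->; rewrite mul0r.
have sum_h_le : \sum_(n < N) `|h`_n| ^+ 2 <= M ^+ 2.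
  rewrite -(ler_pM2l N0) -(discrete_parseval prim_w); last first.
    by rewrite (leq_trans (size_poly _ _)) // /N; lia.
  rewrite mulr_natl -[X in _ *+ X]card_ord -sumr_const; apply: ler_sum => k _.
  rewrite lerXn2r ?nnegrE // hE pM // normrM normrX (norm_prim_root prim_w).
  by rewrite expr1n mulr1 ger0_norm.
have leSN : (S <= N)%N by rewrite /N; lia.
apply: le_trans sum_h_le; rewrite mulr_suml.
rewrite (big_ord_widen N (fun n => `|p`_n| ^+ 2 * r ^+ (2 * S)) leSN).
rewrite big_mkcond.
apply: ler_sum => n _; case: ifP => ltnS; last by rewrite exprn_ge0.
rewrite coef_h normrM exprMn ler_wpM2l ?exprn_ge0 //.
by rewrite normrX (ger0_norm r0) -exprM ler_wiXn2l // mulnC leq_mul2l ltnW.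
Qed.

(** * Fatou's theorem *)

Section TruncatedSeries.
Variable R : nzRingType.
Implicit Types (a : nat -> R) (c : {poly R}) (P : {poly {poly R}}).

Definition fps_trunc a T : {poly R} := \poly_(i < T) a i.

Definition fps_polyM c a n : R := \sum_(i < n.+1) c`_i * a (n - i)%N.

(* P(t, a(t)) = 0: modulo t^T only the truncation of a at order T matters. *)
Definition fps_root P a : Prop :=
  forall T n, (n < T)%N -> (P.[fps_trunc a T])`_n = 0.

Lemma coefM_fps_trunc c a T n :
  (n < T)%N -> (c * fps_trunc a T)`_n = fps_polyM c a n.
Proof.
move=> ltnT; rewrite coefM; apply: eq_bigr => i _.
by rewrite coef_poly ifT // (leq_ltn_trans _ ltnT) ?leq_subr.
Qed.

Lemma fps_rootZ P a c : fps_root P a -> fps_root (c *: P) a.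
Proof.
move=> Pa T n ltnT; rewrite hornerZ coefM big1 // => i _.
by rewrite Pa ?mulr0 // (leq_ltn_trans _ ltnT) ?leq_subr.
Qed.

End TruncatedSeries.

Section SeriesMorphism.
Variables (R S : nzRingType) (f : {rmorphism R -> S}).
Implicit Types (a : nat -> R) (c : {poly R}) (P : {poly {poly R}}).

Lemma map_fps_trunc a T : map_poly f (fps_trunc a T) = fps_trunc (f \o a) T.
Proof.
apply/polyP => n; rewrite coef_map !coef_poly /=.
by case: ifP; rewrite ?rmorph0.
Qed.

Lemma fps_polyM_map c a n :
  fps_polyM (map_poly f c) (f \o a) n = f (fps_polyM c a n).
Proof.
by rewrite rmorph_sum; apply: eq_bigr => i _; rewrite coef_map rmorphM.
Qed.

Lemma fps_root_map P a : injective f ->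
  fps_root (map_poly (map_poly f) P) (f \o a) <-> fps_root P a.
Proof.
move=> f_inj; pose Pf := map_poly (map_poly f) P.
suff PE T n : (Pf.[fps_trunc (f \o a) T])`_n = f (P.[fps_trunc a T])`_n.
  split=> Pa T n /Pa; rewrite PE; last by move->; rewrite rmorph0.
  by rewrite -(rmorph0 f) => /f_inj.
by rewrite -map_fps_trunc horner_map coef_map.
Qed.

End SeriesMorphism.

Lemma natr_mul_geometric_le1 (R : numDomainType) (r : R) n :
  0 <= r <= 1 -> n%:R * (1 - r) * r ^+ n <= 1.
Proof.
move=> /andP[r0 r1]; have r1' : 0 <= 1 - r by rewrite subr_ge0.
apply: (@le_trans _ _ (1 - r ^+ n)); last by rewrite lerBlDr lerDl exprn_ge0.
have -> : 1 - r ^+ n = (1 - r) * \sum_(i < n) r ^+ i.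
  by rewrite -opprB subrX1 -mulNr opprB.
rewrite mulrAC mulrC ler_wpM2l // mulr_natl -[X in _ *+ X]card_ord -sumr_const.
by apply: ler_sum => i _; apply: ler_wiXn2l (ltnW (ltn_ord i)).
Qed.

Lemma geometric_near_le1 (R : archiNumFieldType) (r x : R) :
  0 <= r < 1 -> 0 <= x -> \forall n \near \oo, x * r ^+ n <= 1.
Proof.
move=> /andP[r0 r1] x0; have r1' : 0 < 1 - r by rewrite subr_gt0.
exists (Num.bound (x / (1 - r))) => // n /= len.
apply: le_trans (natr_mul_geometric_le1 n (r := r) _); last by rewrite r0 ltW.
rewrite ler_wpM2r ?exprn_ge0 // -ler_pdivrMr //.
by rewrite (le_trans (ltW (archi_boundP _))) ?ler_nat // divr_ge0 // ltW.
Qed.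

(* That is, the radius of convergence is at least 1. *)
Definition subexponential (a : nat -> algC) : Prop :=
  forall r, 0 <= r < 1 -> exists C, forall n, `|a n| * r ^+ n <= C.

Lemma rootC_ge0_lt1 k (r : algC) : 0 <= r < 1 -> 0 <= k.+1.-root r < 1.
Proof. by move=> /andP[r0 r1]; rewrite rootC_ge0 // r0 rootC_lt1. Qed.

Lemma subexponential_poly_growth (a : nat -> algC) (D : algC) k : 0 <= D ->
  (\forall n \near \oo, `|a n| <= D * n%:R ^+ k) -> subexponential a.
Proof.
move=> D0 [N _ aD] r r01; have /andP[r0 /ltW r1] := r01.
pose s := k.+1.-root r; have /andP[s0 s1] : 0 <= s < 1 by apply: rootC_ge0_lt1.
have s1' : 0 < 1 - s by rewrite subr_gt0.
have growth n : n%:R ^+ k * r ^+ n <= (1 - s)^-1 ^+ k.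
  have -> : r ^+ n = s ^+ n * s ^+ n ^+ k by rewrite -exprS exprAC rootCK.
  rewrite mulrCA -exprMn; apply: le_trans (ler_piMl _ _) _.
  - by rewrite exprn_ge0 // mulr_ge0 ?exprn_ge0.
  - by rewrite exprn_ile1 // ltW.
  rewrite lerXn2r ?nnegrE ?mulr_ge0 ?exprn_ge0 ?invr_ge0 ?(ltW s1') //.
  rewrite -[leRHS]mul1r ler_pdivlMr // mulrAC natr_mul_geometric_le1 //.
  by rewrite s0 ltW.
exists (D * (1 - s)^-1 ^+ k + \sum_(i < N) `|a i|) => n.
have [ltnN | leNn] := ltnP n N.
  rewrite ler_wpDl ?mulr_ge0 ?exprn_ge0 ?invr_ge0 ?(ltW s1') //.
  rewrite (bigD1 (Ordinal ltnN)) //= ler_wpDr ?sumr_ge0 //.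
  by rewrite ler_piMr // exprn_ile1.
rewrite ler_wpDr ?sumr_ge0 //; apply: (@le_trans _ _ (D * n%:R ^+ k * r ^+ n)).
  by rewrite ler_wpM2r ?exprn_ge0 // aD.
by rewrite -mulrA ler_wpM2l.
Qed.

Lemma subexponential_pnorm (a : nat -> algC) r :
    subexponential a -> 0 <= r < 1 ->
  exists2 C, 1 <= C & forall T, pnorm (fps_trunc a T) * r ^+ T <= C.
Proof.
move=> suba r01; pose s := 2.-root r.
have s01 : 0 <= s < 1 by apply: rootC_ge0_lt1.
have [s0 s1] := andP s01; have s1' : 0 < 1 - s by rewrite subr_gt0.
have [C aC] := suba s s01.
have C0 : 0 <= C by apply: le_trans (aC 0%N); rewrite mulr1.
exists (1 + C / (1 - s)); first by rewrite lerDl divr_ge0 // ltW.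
move=> T; rewrite ler_wpDl // (pnorm_wide (size_poly _ _)).
have -> : r ^+ T = s ^+ T * s ^+ T by rewrite -expr2 exprAC rootCK.
rewrite mulrA mulr_suml; apply: (@le_trans _ _ (T%:R * C * s ^+ T)).
  rewrite ler_wpM2r ?exprn_ge0 // mulr_natl -[X in _ *+ X]card_ord -sumr_const.
  apply: ler_sum => i _; rewrite coef_poly ltn_ord; apply: le_trans (aC i).
  by rewrite ler_wpM2l // ler_wiXn2l ?(ltW s1) // ltnW.
rewrite ler_pdivlMr //.
have -> : T%:R * C * s ^+ T * (1 - s) = C * (T%:R * (1 - s) * s ^+ T) by ring.
by rewrite ler_piMr // natr_mul_geometric_le1 // s0 ltW.
Qed.

Section AlgebraicSeries.
Variables (a : nat -> algC) (P : {poly {poly algC}}).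
Hypotheses (subexp_a : subexponential a) (Pa : fps_root P a).
Hypothesis size_P : (1 < size P)%N.

Let c := lead_coef P.

(* P(a_T) is divisible by t^T and its norm grows subexponentially with T, hence
   it is small on every disc of radius r < 1. *)
Lemma near_horner_trunc_le1 r : 0 <= r < 1 ->
  \forall T \near \oo, forall z, `|z| <= r -> `|P.[fps_trunc a T].[z]| <= 1.
Proof.
move=> r01; pose d := size P; pose s := d.+1.-root r.
have s01 : 0 <= s < 1 by apply: rootC_ge0_lt1.
have [/andP[r0 /ltW r1] /andP[s0 s1]] := (r01, s01).
have [C C1 aC] := subexponential_pnorm subexp_a s01.
have C0 : 0 <= bipnorm P * C ^+ d.
  by rewrite mulr_ge0 ?bipnorm_ge0 // exprn_ge0 // (le_trans ler01).
apply: filterS (geometric_near_le1 s01 C0) => T small z zr.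
apply: le_trans (norm_horner_le_pnormM zr r1 (Pa (T := T))) _.
apply: le_trans small; have -> : r ^+ T = s ^+ T ^+ d * s ^+ T.
  by rewrite -exprSr exprAC rootCK.
rewrite mulrA ler_wpM2r ?exprn_ge0 // pnorm_horner_leM ?aC //.
by rewrite exprn_ge0 ?exprn_ile1 // ltW.
Qed.

Lemma lead_coef_fps_sum_sqr_le S :
  \sum_(n < S) `|fps_polyM c a n| ^+ 2 <= 2 * (bipnorm P + 1) ^+ 2.
Proof.
pose r : algC := (2 * S).+1.-root 2^-1.
have r01 : 0 <= r < 1.
  by rewrite rootC_ge0_lt1 // invr_ge0 ler0n invf_lt1 ?ltr1n.
have [r0 /ltW r1] := andP r01.
have [N _ small] := near_horner_trunc_le1 r01.
pose T := maxn N S; have leST : (S <= T)%N := leq_maxr N S.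
have cT z : `|z| = r -> `|(c * fps_trunc a T).[z]| <= bipnorm P + 1.
  move=> zr; apply: le_trans (norm_lead_coef_horner_le _ size_P _) _.
    by rewrite zr.
  by rewrite lerD2l; apply: (small T (leq_maxl N S)); rewrite zr.
have := @sum_sqr_coef_le _ r _ S _ cT; rewrite r0 r1 => /(_ isT).
have -> : \sum_(n < S) `|(c * fps_trunc a T)`_n| ^+ 2 =
          \sum_(n < S) `|fps_polyM c a n| ^+ 2.
  by apply: eq_bigr => n _; rewrite coefM_fps_trunc // (leq_trans _ leST).
move=> le_sum; rewrite -ler_pdivrMl ?ltr0n // mulrC; apply: le_trans le_sum.
rewrite ler_wpM2l ?sumr_ge0 //.
by rewrite -[leLHS](@rootCK _ (2 * S).+1) // -/r exprSr ler_piMr ?exprn_ge0.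
Qed.

End AlgebraicSeries.

Lemma bounded_sum_near0 (u : nat -> nat) (B : nat) :
  (forall S, \sum_(n < S) u n <= B)%N -> \forall n \near \oo, u n = 0%N.
Proof.
move=> leB; pose attained m := `[< exists S, \sum_(n < S) u n = m >]%N.
have attained0 : exists m, attained m.
  by exists 0%N; apply/asboolP; exists 0%N; rewrite big_ord0.
have attained_le m : attained m -> (m <= B)%N by move=> /asboolP[S <-].
case: (ex_maxnP attained0 attained_le) => m /asboolP[S sumS] max_m.
exists S => // n /= leSn.
have /max_m : attained (\sum_(i < n.+1) u i)%N by apply/asboolP; exists n.+1.
have : (\sum_(i < S) u i <= \sum_(i < n) u i)%N.
  rewrite (big_ord_widen n u leSn) big_mkcond.
  by apply: leq_sum => i _; case: ifP.
by rewrite sumS big_ord_recr /=; lia.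
Qed.

Lemma int_sqr_summable_near0 (R : archiNumDomainType) (g : nat -> int) (B : R) :
    (forall S, \sum_(n < S) `|(g n)%:~R : R| ^+ 2 <= B) ->
  \forall n \near \oo, g n = 0.
Proof.
move=> leB; have B0 : 0 <= B by have := leB 0%N; rewrite big_ord0.
have : \forall n \near \oo, (`|g n| ^ 2 = 0)%N.
  apply: (@bounded_sum_near0 _ (Num.bound B)) => S.
  rewrite -(ler_nat R) (le_trans _ (ltW (archi_boundP B0))) //.
  apply: le_trans (leB S); rewrite natr_sum; apply: ler_sum => n _.
  by rewrite natrX natr_absz intr_norm.
by apply: filterS => n /eqP; rewrite expn_eq0 absz_eq0 => /andP[/eqP].
Qed.

Section RationalPowerSeries.
Implicit Types (a : nat -> rat) (p : {poly {poly rat}}).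

Lemma fps_mul_eq_coefM a b (x y : {poly rat}) T :
    (forall n, (n < T)%N -> a n = x`_n) ->
    (forall n, (n < T)%N -> b n = y`_n) ->
  forall n, (n < T)%N -> fps_mul a b n = (x * y)`_n.
Proof.
move=> ax by_ n ltnT; rewrite coefM; apply: eq_bigr => i _.
by rewrite ax ?by_ // (leq_ltn_trans _ ltnT) ?leq_subr // -ltnS.
Qed.

Lemma fps_eval_coef p a T n :
  (n < T)%N -> fps_eval p a n = (p.[fps_trunc a T])`_n.
Proof.
move=> ltnT; rewrite horner_coef coef_sum; apply: eq_bigr => j _.
apply: (@fps_mul_eq_coefM _ _ _ _ T) => // {n ltnT}.
elim: (nat_of_ord j) => [n _ | k IHk n ltnT]; first by rewrite expr0.
rewrite exprS /=; apply: (@fps_mul_eq_coefM _ _ _ _ T) => // i ltiT.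
by rewrite coef_poly ltiT.
Qed.

Lemma map_intr_poly_inj (R : numDomainType) :
  injective (map_poly (intr : int -> R)).
Proof. by apply: map_inj_poly => //; apply: intr_inj. Qed.

Lemma bipoly_clear_denominators p :
  exists (N : int) (P : {poly {poly int}}),
    N != 0 /\ N%:~R%:P *: p = map_poly (map_poly (intr : int -> rat)) P.
Proof.
elim/poly_ind: p => [|p c [N [P [N0 pP]]]].
  by exists 1, 0; rewrite oner_eq0 scaler0 rmorph0.
have [q [M M0 cq]] := rat_poly_scale c.
exists (M * N), (M%:P%:P * P * 'X + (N%:P * q)%:P); split.
  by rewrite mulf_neq0.
have MQ0 : M%:~R != 0 :> rat by rewrite intr_eq0.
rewrite rmorphD !rmorphM /= map_polyX !map_polyC /= !map_polyC /= -pP.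
rewrite -!mul_polyC cq -mul_polyC mulrDr !polyCM !mulrA; congr (_ + _).
by rewrite [_ * (_^-1)%:P%:P]mulrAC -!polyCM mulfV // mul1r.
Qed.

Lemma fps_algebraic_int_root (u : nat -> int) :
    fps_algebraic (fun n => (u n)%:~R) ->
  exists2 P : {poly {poly int}}, (1 < size P)%N & fps_root P u.
Proof.
move=> [p [p0 pu]]; have [N [P [N0 pP]]] := bipoly_clear_denominators p.
have Pu : fps_root P u.
  apply: (fps_root_map P u (@intr_inj rat)).1; rewrite -pP.
  apply: fps_rootZ => T n ltnT.
  by rewrite -[RHS](pu n) (fps_eval_coef _ _ ltnT).
exists P => //; rewrite ltnNge; apply/negP => /size1_polyC.
move: (P`_0) => c Pc.
have c0 : c = 0.
  by apply/polyP => n; have := Pu _ _ (ltnSn n); rewrite Pc hornerC coef0.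
move/eqP: pP; rewrite Pc c0 !rmorph0 -mul_polyC mulf_eq0 !polyC_eq0 intr_eq0.
by rewrite (negPf N0) (negPf p0).
Qed.

Lemma fps_rational_quotient (c q : {poly rat}) a :
    c != 0 -> (forall n, fps_mul (fps_of_poly c) a n = q`_n) -> fps_rational a.
Proof.
elim/poly_ind: c q => [|c k IHc] q; first by rewrite eqxx.
have [-> | k0] := eqVneq k 0; last first.
  move=> _ cq; exists q, (c * 'X + k%:P); split=> //.
  by rewrite coefD coefMX coefC add0r.
rewrite addr0 mulf_eq0 polyX_eq0 orbF => c0 cq.
apply: (IHc (\poly_(i < size q) q`_i.+1)) => // n.
transitivity q`_n.+1.
  rewrite -[RHS]cq /fps_mul [RHS]big_ord_recl /fps_of_poly coefMX mul0r add0r.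
  by apply: eq_bigr => i _; rewrite coefMX.
rewrite coef_poly; case: ltnP => // le_q.
by rewrite nth_default // (leq_trans le_q).
Qed.

Theorem fatou_algebraic_rational (u : nat -> int) :
    subexponential (fun n => (u n)%:~R) ->
    fps_algebraic (fun n => (u n)%:~R) -> fps_rational (fun n => (u n)%:~R).
Proof.
move=> subexp_u /fps_algebraic_int_root[P P1 Pu]; pose c := lead_coef P.
pose PC := map_poly (map_poly (intr : int -> algC)) P.
have PCu : fps_root PC (intr \o u) by apply/fps_root_map => //; apply: intr_inj.
have [N _ cu0] : \forall n \near \oo, fps_polyM c u n = 0.
  apply: (@int_sqr_summable_near0 algC) => S.
  have size_PC : (1 < size PC)%N.
    by rewrite size_map_inj_poly ?rmorph0 //; apply: map_intr_poly_inj.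
  have := lead_coef_fps_sum_sqr_le subexp_u PCu size_PC S.
  rewrite lead_coef_map_inj ?rmorph0 //; last exact: map_intr_poly_inj.
  by under eq_bigr do rewrite (fps_polyM_map (intr : int -> algC)); apply.
pose cQ := map_poly (intr : int -> rat) c; pose g := fps_polyM cQ (intr \o u).
have cQ0 : cQ != 0.
  rewrite -(rmorph0 (map_poly (intr : int -> rat))).
  by rewrite (inj_eq (@map_intr_poly_inj _)) lead_coef_eq0 -size_poly_gt0 ltnW.
apply: (@fps_rational_quotient cQ (fps_trunc g N)) => // n.
rewrite coef_poly; case: ltnP => // /cu0 cu0n.
by rewrite -[LHS]/(g n) /g fps_polyM_map cu0n.
Qed.

End RationalPowerSeries.

(** * Subspaces and their dimension *)

Section Subspaces.
Variables (K : fieldType) (W : lmodType K).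
Implicit Types (U A : set W) (x y : W).

Lemma subspace0 U : is_subspace U -> U 0.
Proof. by case. Qed.

Lemma subspaceZ U a x : is_subspace U -> U x -> U (a *: x).
Proof. by move=> [U0 Ulin] Ux; rewrite -[_ *: _]addr0; apply: Ulin. Qed.

Lemma subspaceD U x y : is_subspace U -> U x -> U y -> U (x + y).
Proof. by move=> [_ Ulin] Ux Uy; rewrite -[x]scale1r; apply: Ulin. Qed.

Lemma subspaceN U x : is_subspace U -> U x -> U (- x).
Proof. by move=> subU Ux; rewrite -scaleN1r; apply: subspaceZ. Qed.

Lemma subspaceB U x y : is_subspace U -> U x -> U y -> U (x - y).
Proof. by move=> subU Ux Uy; apply: subspaceD => //; apply: subspaceN. Qed.

Lemma subspaceI U A : is_subspace U -> is_subspace A -> is_subspace (U `&` A).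
Proof.
move=> [U0 Ulin] [A0 Alin].
by split=> // a x y [Ux Ax] [Uy Ay]; split; [apply: Ulin | apply: Alin].
Qed.

Lemma subspace_sum U (I : Type) (r : seq I) (P : pred I) (f : I -> W) :
    is_subspace U -> (forall i, P i -> U (f i)) ->
  U (\sum_(i <- r | P i) f i).
Proof.
move=> subU Uf; elim/big_ind: _ => // [|x y]; first exact: subspace0.
exact: subspaceD.
Qed.

Lemma lspan_subspace A : is_subspace (lspan A).
Proof.
split=> [U [subU _] | a x y Ax Ay U [subU sAU]]; first exact: subspace0.
by case: (subU) => _; apply; [apply: Ax | apply: Ay].
Qed.

Lemma sub_lspan A : A `<=` lspan A.
Proof. exact: sub_gen_smallest. Qed.

Lemma lspan_sub A U : is_subspace U -> A `<=` U -> lspan A `<=` U.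
Proof. by move=> subU sAU x; apply. Qed.

Lemma lspanS A U : A `<=` U -> lspan A `<=` lspan U.
Proof.
move=> sAU; apply: lspan_sub (lspan_subspace U) _.
exact: subset_trans (@sub_lspan U).
Qed.

Lemma lspan_range_sum d (b : 'I_d -> W) x :
  lspan (range b) x -> exists c : 'I_d -> K, x = \sum_(i < d) c i *: b i.
Proof.
pose U := [set x | exists c : 'I_d -> K, x = \sum_(i < d) c i *: b i].
apply: (@lspan_sub _ U) => [|_ [i _ <-]]; first split.
- by exists (fun=> 0); rewrite big1 // => i _; rewrite scale0r.
- move=> a _ _ [c1 ->] [c2 ->]; exists (fun i => a * c1 i + c2 i).
  rewrite scaler_sumr -big_split; apply: eq_bigr => i _ /=.
  by rewrite scalerDl scalerA.
exists (fun j => (j == i)%:R); rewrite (bigD1 i) //= eqxx scale1r.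
by rewrite big1 ?addr0 // => j /negPf ->; rewrite scale0r.
Qed.

End Subspaces.

Section Dimension.
Variables (K : fieldType) (W : lmodType K).
Implicit Types (U A : set W) (x : W).

Lemma lin_indep_leq d k (b : 'I_d -> W) (s : 'I_k -> W) :
  lin_indep b -> (forall i, lspan (range s) (b i)) -> (d <= k)%N.
Proof.
move=> free_b sb.
have /(_ _)/lspan_range_sum/cid-/all_tag[c bE] := sb.
pose M := \matrix_(i, j) c i j.
apply: contraT; rewrite -ltnNge => lt_kd.
have /rowV0Pn[v vM v0] : kermx M != 0.
  rewrite -mxrank_eq0 mxrank_ker subn_eq0 -ltnNge.
  exact: leq_ltn_trans (rank_leq_col M) lt_kd.
case/eqP: v0; apply/rowP => i; rewrite mxE; move: i; apply: free_b.
under eq_bigr do rewrite bE scaler_sumr.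
rewrite exchange_big big1 // => j _ /=.
under eq_bigr do rewrite scalerA.
rewrite -scaler_suml; move/sub_kermxP/rowP/(_ j): vM; rewrite !mxE.
by under eq_bigr do rewrite mxE; move->; rewrite scale0r.
Qed.

Lemma has_dim_leq U A d k :
  U `<=` A -> has_dim U d -> has_dim A k -> (d <= k)%N.
Proof.
move=> sUA [b [free_b bU]] [s [_ sA]].
apply: (lin_indep_leq (s := s) free_b) => i.
by rewrite sA; apply: sUA; rewrite -bU; apply: sub_lspan; exists i.
Qed.

Lemma dimK_leq U A : U `<=` A -> finite_dim A -> (dimK U <= dimK A)%N.
Proof.
move=> sUA [k Ak]; rewrite /dimK.
case: xgetP => [d _ /= Ud | _ //].
case: xgetP => [k' _ /= Ak' | /(_ k)//].
exact: has_dim_leq sUA Ud Ak'.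
Qed.

Lemma lin_indep_cons d (b : 'I_d -> W) x :
    lin_indep b -> ~ lspan (range b) x ->
  lin_indep (fun i => if unlift ord0 i is Some j then b j else x).
Proof.
move=> free_b bx c; rewrite big_ord_recl unlift_none.
under eq_bigr do rewrite liftK.
set y := \sum_(i < d) _; have subS := lspan_subspace (range b).
have span_y : lspan (range b) y.
  apply: (subspace_sum _ subS) => i _; apply: (subspaceZ _ subS).
  by apply: sub_lspan; exists i.
have [c0 | c0 /eqP eq0] := eqVneq (c ord0) 0.
  rewrite c0 scale0r add0r => /free_b cS i.
  by case: (unliftP ord0 i) => [j|] ->.
case: bx; rewrite -[x](scalerK c0); apply: (subspaceZ _ subS).
by move: eq0; rewrite addr_eq0 => /eqP ->; apply: (subspaceN subS).
Qed.

Definition fin_spanned U : Prop :=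
  exists s : seq W, U `<=` lspan [set x | x \in s].

Lemma finite_dim_fin_spanned U : finite_dim U -> fin_spanned U.
Proof.
move=> [d [b [_ <-]]]; exists (codom b).
by apply: lspanS => _ [i _ <-]; apply: codom_f.
Qed.

Lemma fin_spanned_finite_dim U : is_subspace U -> fin_spanned U -> finite_dim U.
Proof.
move=> subU [s sUs].
pose free_in_U d :=
  `[< exists b : 'I_d -> W, lin_indep b /\ forall i, U (b i) >].
have free_in_U0 : exists d, free_in_U d.
  by exists 0%N; apply/asboolP; exists (fun=> 0); split => [c _|] [].
have free_in_U_le d : free_in_U d -> (d <= size s)%N.
  move=> /asboolP[b [free_b Ub]].
  apply: (@lin_indep_leq _ _ _ (fun i : 'I_(size s) => nth 0 s i) free_b) => i.
  apply: lspanS (sUs _ (Ub i)) => x /= xs.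
  have ltx : (index x s < size s)%N by rewrite index_mem.
  by exists (Ordinal ltx) => //=; rewrite nth_index.
case: (ex_maxnP free_in_U0 free_in_U_le) => d /asboolP[b [free_b Ub]] max_d.
exists d, b; split=> //; apply/seteqP; split.
  by apply: lspan_sub => // _ [i _ <-].
move=> x Ux; apply: contrapT => bx.
have /max_d : free_in_U d.+1; last by rewrite ltnn.
apply/asboolP; exists (fun i => if unlift ord0 i is Some j then b j else x).
split; first exact: lin_indep_cons.
by move=> i; case: (unlift ord0 i).
Qed.

End Dimension.

Section SubspaceSums.
Variables (K : fieldType) (W : lmodType K) (H : nat -> set W).

Definition sum_lt N : set W :=
  [set x | exists f, (forall i, H i (f i)) /\ x = \sum_(i < N) f i].

Definition sum_all : set W := [set x | exists N, sum_lt N x].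

Lemma big_ord_pad N M (f : nat -> W) : (N <= M)%N ->
  \sum_(i < N) f i = \sum_(i < M) (if (i < N)%N then f i else 0).
Proof. by move=> leNM; rewrite (big_ord_widen M f) // big_mkcond. Qed.

Hypothesis subH : forall i, is_subspace (H i).

Lemma sum_lt_subspace N : is_subspace (sum_lt N).
Proof.
split=> [|a _ _ [f [Hf ->]] [g [Hg ->]]].
  by exists (fun=> 0); split=> [i|]; [apply: subspace0 | rewrite big1].
exists (fun i => a *: f i + g i); split=> [i|].
  by case: (subH i) => _; apply.
by rewrite big_split scaler_sumr.
Qed.

Lemma sum_ltS N M : (N <= M)%N -> sum_lt N `<=` sum_lt M.
Proof.
move=> leNM _ [f [Hf ->]].
exists (fun i => if (i < N)%N then f i else 0); split; last exact: big_ord_pad.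
by move=> i; case: ifP => // _; apply: subspace0.
Qed.

Lemma sub_sum_lt N i : (i < N)%N -> H i `<=` sum_lt N.
Proof.
move=> lt_iN x Hx; exists (fun j => if j == i then x else 0); split.
  by move=> j; case: eqP => [-> // | _]; apply: subspace0.
by rewrite -big_mkcond (big_pred1 (Ordinal lt_iN)).
Qed.

Lemma sub_sum_all i : H i `<=` sum_all.
Proof. by move=> x Hx; exists i.+1; apply: sub_sum_lt Hx. Qed.

Lemma sum_all_subspace : is_subspace sum_all.
Proof.
split=> [|a x y [N Hx] [M Hy]].
  by exists 0%N; apply: (subspace0 (sum_lt_subspace 0)).
exists (maxn N M); case: (sum_lt_subspace (maxn N M)) => _; apply.
  by apply: sum_ltS Hx; apply: leq_maxl.
by apply: sum_ltS Hy; apply: leq_maxr.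
Qed.

Lemma sum_lt_fin_spanned N :
  (forall i, fin_spanned (H i)) -> fin_spanned (sum_lt N).
Proof.
move=> /(_ _)/cid-/all_tag[s sH].
pose t := flatten [seq s i | i <- iota 0 N].
have sub_t (i : 'I_N) : [set x | x \in s i] `<=` [set x | x \in t].
  move=> x /= xs; apply/flattenP; exists (s i) => //.
  by rewrite map_f // mem_iota /=.
exists t => _ [f [Hf ->]].
apply: (subspace_sum _ (lspan_subspace _)) => i _.
exact: lspanS (@sub_t i) _ (sH i _ (Hf i)).
Qed.

End SubspaceSums.

(** * Growth of graded algebras *)

Section Algebra.
Variables (K : fieldType) (R : assocAlg K).
Implicit Types (x y e : R) (A B U V S : set R) (H : nat -> set R).

Lemma amul0l x : amul 0 x = 0.
Proof. by rewrite -[X in amul X _](scale0r 0) amulZl scale0r. Qed.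

Lemma amul0r x : amul x 0 = 0.
Proof. by rewrite -[X in amul _ X](scale0r 0) amulZr scale0r. Qed.

Lemma amul_suml (I : Type) (r : seq I) (f : I -> R) x :
  amul (\sum_(i <- r) f i) x = \sum_(i <- r) amul (f i) x.
Proof.
by apply: (big_morph (fun y => amul y x)) => [y z|]; rewrite ?amulDl ?amul0l.
Qed.

Lemma amul_sumr (I : Type) (r : seq I) (f : I -> R) x :
  amul x (\sum_(i <- r) f i) = \sum_(i <- r) amul x (f i).
Proof.
by apply: (big_morph (amul x)) => [y z|]; rewrite ?amulDr ?amul0r.
Qed.

Lemma is_one_unique e e' : is_one e -> is_one e' -> e = e'.
Proof. by move=> /(_ e')[_ e'e] /(_ e)[ee' _]; rewrite -ee' e'e. Qed.

Lemma generates_ind V S :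
  generates V -> is_subalg S -> V `<=` S -> forall x, S x.
Proof.
move=> genV algS sVS x.
by have : [set: R] x by []; rewrite -genV; apply.
Qed.

Lemma lspan_amul A B U : is_subspace U ->
    (forall x y, A x -> B y -> U (amul x y)) ->
  forall x y, lspan A x -> lspan B y -> U (amul x y).
Proof.
move=> subU ABU x y Ax; move: y; apply: lspan_sub.
  split=> [|a y z /= Uy Uz]; first by rewrite /= amul0r; apply: subspace0.
  by rewrite amulDr amulZr; case: subU => _; apply.
move=> y By /=; move: x Ax; apply: lspan_sub.
  split=> [|a x z /= Ux Uz]; first by rewrite /= amul0l; apply: subspace0.
  by rewrite amulDl amulZl; case: subU => _; apply.
by move=> x Ax; apply: ABU.
Qed.

Lemma fin_spanned_amul A B : fin_spanned A -> fin_spanned B ->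
  fin_spanned [set z | exists x y, [/\ A x, B y & z = amul x y]].
Proof.
move=> [s sA] [t tB]; exists [seq amul x y | x <- s, y <- t].
move=> _ [x [y [/sA xs /tB yt ->]]]; move: xs yt.
apply: lspan_amul; first exact: lspan_subspace.
move=> {}x {}y xs yt; apply: sub_lspan.
by apply/allpairsP; exists (x, y).
Qed.

Definition graded_mul H : Prop :=
  forall m n x y, H m x -> H n y -> H (m + n)%N (amul x y).

Lemma sum_lt_amul H m n x y : (forall i, is_subspace (H i)) -> graded_mul H ->
  sum_lt H m.+1 x -> sum_lt H n.+1 y -> sum_lt H (m + n).+1 (amul x y).
Proof.
move=> subH mulH [f [Hf ->]] [g [Hg ->]].
have subS := sum_lt_subspace subH (m + n).+1; rewrite amul_suml.
apply: (subspace_sum _ subS) => i _; rewrite amul_sumr.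
apply: (subspace_sum _ subS) => j _; apply: (sub_sum_lt subH (i := i + j)).
  by rewrite ltnS leq_add // -ltnS.
exact: mulH.
Qed.

Lemma sum_all_subalg H : (forall i, is_subspace (H i)) -> graded_mul H ->
  (forall e, is_one e -> H 0%N e) -> is_subalg (sum_all H).
Proof.
move=> subH mulH H1; split; first exact: sum_all_subspace.
  move=> x y [N Hx] [M Hy]; exists (N + M).+1.
  by apply: sum_lt_amul => //; [apply: sum_ltS Hx | apply: sum_ltS Hy].
by move=> e /H1; apply: sub_sum_all.
Qed.

End Algebra.

Section PowerFiltration.
Variables (K : fieldType) (R : assocAlg K) (V : set R).
Implicit Types x y e : R.

Lemma foldl_amul x y (s : seq R) :
  foldl (@amul K R) (amul x y) s = amul x (foldl (@amul K R) y s).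
Proof. by elim: s y => //= z s IHs y; rewrite -amulA IHs. Qed.

Lemma products_graded_mul : graded_mul (products V).
Proof.
move=> [|i] [|j] x y /=.
- by move=> x1 /[dup] y1 /(_ x)[_ ->].
- by move=> /(_ y)[-> _].
- by move=> + /(_ x)[_ ->]; rewrite addn0.
move=> [z [s [Vz Vs sz ->]]] [t [r [Vt Vr sr ->]]].
exists z, (s ++ t :: r); split=> //.
- move=> u; rewrite mem_cat inE => /or3P[/Vs // | /eqP -> // | /Vr //].
- by rewrite size_cat /= sz sr addnS.
by rewrite foldl_cat /= foldl_amul.
Qed.

Lemma productsSr i : products V i.+2 =
  [set z | exists x y, [/\ products V i.+1 x, V y & z = amul x y]].
Proof.
apply/seteqP; split; last first.
  move=> _ [x [y [Vx Vy ->]]]; rewrite -addn1; apply: products_graded_mul => //.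
  by exists y, [::].
move=> _ [x [s [Vx Vs ss ->]]]; case/lastP: s Vs ss => // s y Vs.
rewrite size_rcons => -[ss].
exists (foldl (@amul K R) x s), y; split; last by rewrite foldl_rcons.
  by exists x, s; split=> // z zs; apply: Vs; rewrite mem_rcons inE zs orbT.
by apply: Vs; rewrite mem_rcons mem_head.
Qed.

Lemma vpow_subspace i : is_subspace (vpow V i).
Proof. exact: lspan_subspace. Qed.

Lemma vpow_graded_mul : graded_mul (vpow V).
Proof.
move=> i j x y; apply: lspan_amul; first exact: vpow_subspace.
by move=> u v Vu Vv; apply: sub_lspan; apply: products_graded_mul.
Qed.

Lemma is_one_vpow0 e : is_one e -> vpow V 0 e.
Proof. by move=> e1; apply: sub_lspan. Qed.

Lemma sub_vpow1 : V `<=` vpow V 1.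
Proof. by move=> x Vx; apply: sub_lspan; exists x, [::]. Qed.

Lemma vpow_fin_spanned i : fin_spanned V -> fin_spanned (vpow V i).
Proof.
move=> finV; suff [s sV] : fin_spanned (products V i).
  by exists s; apply: lspan_sub => //; apply: lspan_subspace.
case: i => [|i].
  exists [:: xget 0 [set e : R | is_one e]] => e e1; apply: sub_lspan => /=.
  rewrite inE; apply/eqP.
  by case: xgetP => [e' _ /(is_one_unique e1) | /(_ e e1)].
elim: i => [|i IHi]; last by rewrite productsSr; apply: fin_spanned_amul.
by case: finV => s sV; exists s => _ [x [r [Vx _ /size0nil -> ->]]]; apply: sV.
Qed.

Lemma vpow_sum_subspace n : is_subspace (vpow_sum V n).
Proof. exact: sum_lt_subspace vpow_subspace n.+1. Qed.

Lemma vpow_sumS m n : (m <= n)%N -> vpow_sum V m `<=` vpow_sum V n.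
Proof. exact: (sum_ltS vpow_subspace (N := m.+1) (M := n.+1)). Qed.

Lemma sub_vpow_sum i n : (i <= n)%N -> vpow V i `<=` vpow_sum V n.
Proof. exact: (sub_sum_lt vpow_subspace (N := n.+1)). Qed.

Lemma vpow_sum_graded_mul : graded_mul (vpow_sum V).
Proof. by move=> m n x y; apply: sum_lt_amul vpow_subspace vpow_graded_mul. Qed.

Lemma is_one_vpow_sum e n : is_one e -> vpow_sum V n e.
Proof. by move=> /is_one_vpow0; apply: sub_vpow_sum. Qed.

Lemma vpow_sum_finite_dim n : fin_spanned V -> finite_dim (vpow_sum V n).
Proof.
move=> finV; apply: fin_spanned_finite_dim; first exact: vpow_sum_subspace.
by apply: sum_lt_fin_spanned => i; apply: vpow_fin_spanned.
Qed.

Lemma vpow_sum_exhaust x : generates V -> exists n, vpow_sum V n x.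
Proof.
move=> genV; have [||N Vx] := generates_ind (S := sum_all (vpow V)) genV _ _ x.
- exact: sum_all_subalg vpow_subspace vpow_graded_mul is_one_vpow0.
- by move=> y /sub_vpow1; apply: sub_sum_all vpow_subspace _ _.
by exists N; apply: sum_ltS Vx => //; apply: vpow_subspace.
Qed.

Lemma vpow_sum_exhaust_finite (I : finType) (f : I -> R) : generates V ->
  exists k, forall i, vpow_sum V k (f i).
Proof.
move=> genV.
have /(_ _)/cid-/all_tag[k Vk] := fun i => vpow_sum_exhaust (f i) genV.
exists (\max_i k i)%N => i; apply: vpow_sumS (Vk i).
exact: leq_bigmax.
Qed.

End PowerFiltration.

Section Grading.
Variables (K : fieldType) (R : assocAlg K) (G : nat -> set R).
Hypothesis gradG : is_grading G.

Let subG := grading_subspace gradG.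

Lemma grading_component N (f : nat -> R) n x :
    (forall i, G i (f i)) -> G n x -> x = \sum_(i < N) f i ->
  x = if (n < N)%N then f n else 0.
Proof.
move=> Gf Gx xE.
pose h i := (if (i < N)%N then f i else 0) - (if i == n then x else 0).
have Gh i : G i (h i).
  apply: subspaceB => //; first by case: ifP => // _; apply: subspace0.
  by case: eqP => [-> // | _]; apply: subspace0.
have ltn_max : (n < maxn N n.+1)%N by rewrite leq_maxr.
have sum_h : \sum_(i < maxn N n.+1) h i = 0.
  rewrite sumrB -big_ord_pad ?leq_maxl // -xE.
  by rewrite -big_mkcond (big_pred1 (Ordinal ltn_max)) ?subrr.
have /eqP := grading_direct gradG Gh sum_h ltn_max.
by rewrite /h eqxx subr_eq0 => /eqP.
Qed.

Lemma grading_sum_all_sub (H : nat -> set R) n x :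
    (forall i, is_subspace (H i)) -> (forall i, H i `<=` G i) ->
  sum_all H x -> G n x -> H n x.
Proof.
move=> subH sHG [N [f [Hf xE]]] Gx.
rewrite (grading_component (fun i => sHG i _ (Hf i)) Gx xE).
by case: ifP => // _; apply: subspace0.
Qed.

Lemma grading_direct_shift n N (f : nat -> R) :
    (forall i, G (n + i)%N (f i)) -> \sum_(i < N) f i = 0 ->
  forall i, (i < N)%N -> f i = 0.
Proof.
move=> Gf sum_f i lt_iN; pose h j := if (n <= j)%N then f (j - n)%N else 0.
have Gh j : G j (h j).
  rewrite /h; case: leqP => [/subnKC {1}<- // | _]; exact: subspace0.
have sum_h : \sum_(j < n + N) h j = 0.
  rewrite big_split_ord /= big1 ?add0r => [|j _]; last first.
    by rewrite /h leqNgt ltn_ord.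
  by under eq_bigr do rewrite /h leq_addr addKn.
have := grading_direct gradG Gh sum_h (i := n + i).
by rewrite /h leq_addr addKn; apply; rewrite ltn_add2l.
Qed.

(* The degree 0 component of an identity element is again a left identity. *)
Lemma is_one_degree0 e : is_one e -> G 0%N e.
Proof.
move=> e1; have [N [f [Gf eE]]] := grading_span gradG e.
have [N0 | N0] := posnP N; first by rewrite eE N0 big_ord0; apply: subspace0.
have f0_homog n x : G n x -> amul (f 0%N) x = x.
  move=> Gx; pose h i := amul (f i) x - (if i == 0%N then x else 0).
  have Gh i : G (n + i)%N (h i).
    rewrite addnC; apply: subspaceB => //; first exact: grading_mul.
    by case: eqP => [-> // | _]; apply: subspace0.
  have sum_h : \sum_(i < N) h i = 0.
    rewrite sumrB -amul_suml -eE (e1 x).1 -big_mkcond.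
    by rewrite (big_pred1 (Ordinal N0)) ?subrr.
  by apply/eqP; rewrite -subr_eq0 -(grading_direct_shift Gh sum_h N0) /h eqxx.
suff -> : e = f 0%N by [].
rewrite -[RHS](e1 _).2 [in RHS]eE amul_sumr [LHS]eE.
by apply: eq_bigr => i _; rewrite (f0_homog i).
Qed.

End Grading.

Section GradedGrowth.
Variables (K : fieldType) (R : assocAlg K) (G : nat -> set R) (V : set R).
Hypothesis gradG : is_grading G.
Hypothesis degree0G : G 0%N = [set 0] \/ degree0_is_field G.
Hypotheses (finV : finite_dim V) (genV : generates V).

Lemma degree0_sub_vpow_sum n : G 0%N `<=` vpow_sum V n.
Proof.
have subF := vpow_sum_subspace V n.
case: degree0G => [-> _ -> | [e [_ e1 ->]] _ [c _ <-]]; first exact: subspace0.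
by apply: (subspaceZ _ subF); apply: is_one_vpow_sum.
Qed.

Definition degree_vpow_sum k n : set R := G n `&` vpow_sum V (k * n).

Lemma degree_vpow_sum_subspace k n : is_subspace (degree_vpow_sum k n).
Proof. exact: subspaceI (grading_subspace gradG n) (vpow_sum_subspace V _). Qed.

Lemma degree_vpow_sum_subalg k : is_subalg (sum_all (degree_vpow_sum k)).
Proof.
apply: sum_all_subalg; first exact: degree_vpow_sum_subspace.
  move=> m n x y [Gx Vx] [Gy Vy].
  by split; [apply: grading_mul | rewrite mulnDr; apply: vpow_sum_graded_mul].
by move=> e e1; split; [apply: is_one_degree0 | apply: is_one_vpow_sum].
Qed.

(* The homogeneous components of positive degree of a basis of V all lie in some
   V^0 + ... + V^k, and those of degree 0 are scalars. *)
Lemma sub_sum_degree_vpow_sum :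
  exists2 k, (0 < k)%N & V `<=` sum_all (degree_vpow_sum k).
Proof.
have [d [b [_ bV]]] := finV.
have /(_ _)/cid-/all_tag[N /(_ _)/cid-/all_tag[f bE]] :=
  fun i => grading_span gradG (b i).
pose M := (\max_i N i)%N.
pose component (ij : 'I_d * 'I_M) := f ij.1 ij.2.
have [k Vk] := vpow_sum_exhaust_finite component genV.
exists k.+1 => //; have subH := degree_vpow_sum_subspace k.+1.
have subS := sum_all_subspace subH.
rewrite -bV; apply: lspan_sub => // _ [i _ <-].
have [Gf ->] := bE i; apply: (subspace_sum _ subS) => -[j ltj] _ /=.
apply: (sub_sum_all subH (i := j)); split=> //; case: j ltj => [|j] ltj.
  exact: degree0_sub_vpow_sum.
have ltjM : (j.+1 < M)%N by apply: leq_trans ltj _; apply: leq_bigmax.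
by apply: vpow_sumS (Vk (i, Ordinal ltjM)); rewrite mulnS; lia.
Qed.

Lemma degree_sub_vpow_sum :
  exists2 k, (0 < k)%N & forall n, G n `<=` vpow_sum V (k * n).
Proof.
have [k k0 sV] := sub_sum_degree_vpow_sum; exists k => // n x Gx.
have subH := degree_vpow_sum_subspace k.
have Hx := generates_ind genV (degree_vpow_sum_subalg k) sV x.
have sub_G i : degree_vpow_sum k i `<=` G i by move=> y [].
by have [] := grading_sum_all_sub gradG subH sub_G Hx Gx.
Qed.

Lemma dimK_degree_leq_growth :
  exists2 k, (0 < k)%N & forall n, (dimK (G n) <= growth V (k * n))%N.
Proof.
have [k k0 sub_k] := degree_sub_vpow_sum; exists k => // n.
apply: dimK_leq (sub_k n) _; apply: vpow_sum_finite_dim.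
exact: finite_dim_fin_spanned.
Qed.

End GradedGrowth.

Section GelfandKirillovDimension.
Variable RR : realType.

Lemma limf_esup_lt_near (T : choiceType) (X : filteredType T)
    (F : set_system X) {FF : Filter F} (f : X -> \bar RR) (y : \bar RR) :
  (limf_esup f F < y)%E -> \forall x \near F, (f x < y)%E.
Proof.
move=> /ereal_inf_lt[_ [S FS <-] sup_lt].
apply: filterS FS => x Sx; apply: le_lt_trans sup_lt.
by apply: ereal_sup_ubound; exists x.
Qed.

Lemma lty_natr (x : \bar RR) : (x < +oo)%E -> exists A : nat, (x < A%:R%:E)%E.
Proof.
case: x => [r _ | // | _]; last by exists 0%N; rewrite ltNyr.
exists (Num.bound `|r|); rewrite lte_fin.
exact: le_lt_trans (ler_norm r) (archi_boundP _).
Qed.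

Lemma GKdim_lt_growth (K : fieldType) (R : assocAlg K) (V : set R) (A : nat) :
    (GKdim RR V < A%:R%:E)%E ->
  \forall n \near \oo, (growth V n <= n ^ A)%N.
Proof.
move=> /limf_esup_lt_near GK_lt; near=> n.
have n1 : (1 < n)%N by near: n; apply: nbhs_infty_gt.
have : (ln (growth V n)%:R / ln n%:R < A%:R :> RR) by rewrite -lte_fin; near: n.
have [-> // | growth0] := posnP (growth V n).
rewrite ltr_pdivrMr ?ln_gt0 ?ltr1n // mulr_natl -lnXn ?ltr0n ?(ltnW n1) //.
rewrite ltr_ln ?posrE ?exprn_gt0 ?ltr0n ?(ltnW n1) // -natrX ltr_nat.
exact: ltnW.
Unshelve. all: by end_near.
Qed.

End GelfandKirillovDimension.

Theorem theorem4p2 (RR : realType) (K : fieldType) (R : assocAlg K)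
    (G : nat -> set R) (V : set R)
    (hG : is_grading G)
    (hG0 : G 0%N = [set 0] \/ degree0_is_field G)
    (hVfin : finite_dim V) (hVgen : generates V)
    (hGK : (GKdim RR V < +oo)%E) :
  fps_rational (hilbert_series G) \/ fps_transcendental (hilbert_series G).
Proof.
have [alg | ] := pselect (fps_algebraic (hilbert_series G)); last by right.
left; apply: (@fatou_algebraic_rational (fun n => dimK (G n))) => //.
have [k k0 dim_le] := dimK_degree_leq_growth hG hG0 hVfin hVgen.
have [A /GKdim_lt_growth[N _ growth_le]] := lty_natr hGK.
apply: (@subexponential_poly_growth _ (k ^ A)%:R A); first exact: ler0n.
exists N => // n /= leNn.
rewrite -natrX -natrM -expnMn ger0_norm ?ler0n // ler_nat.
apply: leq_trans (dim_le n) (growth_le _ _) => /=.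
exact: leq_trans leNn (leq_pmull _ _).
Qed.
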